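(* Let $G=(U\cup W,E)$ be a non-trivial circular graph and let $u\in U$. Put $U'=U\setminus\{u\}$, $S=\{x\in W: x\notin N(u)\}$ and $W'=W\setminus S$ (so $W'=N(u)$), and let $G'=(U'\cup W',E')$ be the bipartite graph in which $u'\in U'$ and $w'\in W'$ are adjacent iff $u'w'\in E$. Then $G'$ is a linear graph with parts $U'$ and $W'$.
   Context: All graphs are finite and simple. For vertices $v_1,\dots,v_k$, $CN(v_1,\dots,v_k)$ denotes the set of common neighbours and $cn(v_1,\dots,v_k)=|CN(v_1,\dots,v_k)|$. A circular graph is a finite bipartite graph $G$ with a specified bipartition $V(G)=U\cup W$ into nonempty sets ($U\cap W=\emptyset$, every edge joins $U$ to $W$) such that (i) $cn(u_i,u_j,u_k)=1$ for all distinct $u_i,u_j,u_k\in U$, and (ii) $d(w)\ge 3$ for every $w\in W$. It is trivial if $|U|=1$ or $|W|=1$, and non-trivial otherwise. A linear graph is a bipartite graph with parts $\mathcal{P}$ and $\mathcal{L}$ such that $cn(p,q)=1$ for all distinct $p,q\in\mathcal{P}$, and $\delta\ge 2$ (minimum degree at least 2). *)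

(* Defs.v *)
From mathcomp Require Import all_boot.
Set Implicit Arguments.
Unset Strict Implicit.
Unset Printing Implicit Defensive.

(* A finite simple graph whose vertices form a subset [verts] of an ambient
   finite type, so that a graph and its subgraphs can share one type. *)
Record graph (T : finType) := Graph {
  verts : {set T};
  edge : rel T;
  edge_sym : symmetric edge;
  edge_irr : irreflexive edge;
  edge_verts : forall x y, edge x y -> x \in verts
}.

Section Graphs.
Variable T : finType.
Implicit Types (G : graph T) (U W P L A B : {set T}) (u v x y : T).

Definition nbr G x : {set T} := [set y in verts G | edge G x y].

Definition deg G x : nat := #|nbr G x|.

(* CN(v_1, ..., v_k) is [common_nbr G [:: v_1; ...; v_k]]. *)
Definition common_nbr G (s : seq T) : {set T} :=
  [set x in verts G | all (edge G x) s].

Definition cn G (s : seq T) : nat := #|common_nbr G s|.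

Definition bipartition G U W : Prop :=
  [/\ U :|: W = verts G,
      [disjoint U & W] &
      forall x y, edge G x y ->
        (x \in U /\ y \in W) \/ (x \in W /\ y \in U)].

Definition circular_graph G U W : Prop :=
  [/\ bipartition G U W,
      U != set0,
      W != set0,
      (forall x y z, x \in U -> y \in U -> z \in U ->
         x <> y -> x <> z -> y <> z -> cn G [:: x; y; z] = 1) &
      forall w, w \in W -> 3 <= deg G w].

Definition trivial_circular U W : Prop := #|U| = 1 \/ #|W| = 1.

Definition nontrivial_circular_graph G U W : Prop :=
  circular_graph G U W /\ ~ trivial_circular U W.

Definition linear_graph G P L : Prop :=
  [/\ bipartition G P L,
      (forall p q, p \in P -> q \in P -> p <> q -> cn G [:: p; q] = 1) &
      forall x, x \in verts G -> 2 <= deg G x].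

Definition between_edge G A B : rel T :=
  fun x y => edge G x y &&
    ((x \in A) && (y \in B) || (x \in B) && (y \in A)).

Lemma between_edge_sym G A B : symmetric (between_edge G A B).
Proof.
by move=> x y; rewrite /between_edge edge_sym orbC andbC [_ && (x \in B)]andbC
  [_ && (x \in A)]andbC andbC.
Qed.

Lemma between_edge_irr G A B : irreflexive (between_edge G A B).
Proof. by move=> x; rewrite /between_edge edge_irr. Qed.

Lemma between_edge_verts G A B x y :
  between_edge G A B x y -> x \in A :|: B.
Proof.
by rewrite inE => /andP[_ /orP[] /andP[-> _]]; rewrite ?orbT.
Qed.

Definition between G A B : graph T :=
  Graph (@between_edge_sym G A B) (@between_edge_irr G A B)
        (@between_edge_verts G A B).

End Graphs.

(* Main.v *)
(* A common neighbour of p and q in G' is the same thing as a common neighbour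
   of u, p and q in G, which gives cn(p, q) = 1. A vertex of N(u) loses only
   the neighbour u. If p in U' had degree less than 2 in G', then u and p would
   have a single common neighbour w, so w would be adjacent to all of U; any
   other w' in W has three neighbours, whose common neighbours include both w
   and w', a contradiction. *)
Require Import Defs.
From mathcomp Require Import all_boot.

Section Bipartite.
Set Implicit Arguments.
Unset Strict Implicit.
Variables (T : finType) (G : graph T) (U W : {set T}).
Hypothesis bipUW : bipartition G U W.

Lemma bipartition_notin x : x \in U -> x \in W -> False.
Proof.
by case: bipUW => _ /pred0P dUW _ xU xW; move: (dUW x); rewrite /= xU xW.
Qed.

Lemma edge_partL x y : x \in U -> edge G x y -> y \in W.
Proof.
case: bipUW => _ _ e xU /e[[_ //]|[xW _]].
by case: (bipartition_notin xU xW).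
Qed.

Lemma edge_partR x y : x \in W -> edge G x y -> y \in U.
Proof.
case: bipUW => _ _ e xW /e[[xU _]|[_ //]].
by case: (bipartition_notin xU xW).
Qed.

End Bipartite.

Lemma in_nbr {T : finType} (G : graph T) x y : (y \in nbr G x) = edge G x y.
Proof.
rewrite inE andbC; case: (boolP (edge G x y)) => //=.
by rewrite edge_sym => /edge_verts.
Qed.

(** The list must be nonempty: the edge from [y] to [x] is what places [y] in [verts G]. *)
Lemma in_common_nbr {T : finType} (G : graph T) x s y :
  (y \in common_nbr G (x :: s)) = all (edge G y) (x :: s).
Proof.
rewrite inE andbC /=; case: (boolP (edge G y x)) => //= /edge_verts ->.
by rewrite andbT.
Qed.

Section Circular.
Set Implicit Arguments.
Unset Strict Implicit.
Variables (T : finType) (G : graph T) (U W : {set T}).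
Hypothesis circG : circular_graph G U W.

Lemma circular_bipartition : bipartition G U W.
Proof. by case: circG. Qed.

Lemma nbr_partR w : w \in W -> nbr G w \subset U.
Proof.
move=> wW; apply/subsetP => x; rewrite in_nbr.
exact: (edge_partR circular_bipartition wW).
Qed.

Lemma circular_card_partL : 2 < #|U|.
Proof.
case: (circG) => _ _ /set0Pn[w wW] _ /(_ w wW) d.
exact: (leq_trans d (subset_leq_card (nbr_partR wW))).
Qed.

Lemma circular_eq_nbr x y z v w :
    x \in U -> y \in U -> z \in U -> x != y -> x != z -> y != z ->
    all (edge G v) [:: x; y; z] -> all (edge G w) [:: x; y; z] ->
  v = w.
Proof.
move=> xU yU zU /eqP xy /eqP xz /eqP yz; rewrite -!in_common_nbr.
case: circG => _ _ _ /(_ x y z xU yU zU xy xz yz) /eqP/cards1P[a ->] _.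
by rewrite !inE => /eqP-> /eqP->.
Qed.

Lemma circular_ex_nbr x y z :
    x \in U -> y \in U -> z \in U -> x != y -> x != z -> y != z ->
  exists w, all (edge G w) [:: x; y; z].
Proof.
move=> xU yU zU /eqP xy /eqP xz /eqP yz.
case: circG => _ _ _ /(_ x y z xU yU zU xy xz yz) /eqP/cards1P[a E] _.
by exists a; rewrite -in_common_nbr E set11.
Qed.

Lemma circular_common_nbr2 x y :
  #|W| != 1 -> x \in U -> y \in U -> x != y -> 1 < cn G [:: x; y].
Proof.
move=> W1 xU yU xy; rewrite ltnNge; apply/negP => /card_le1_eqP cn_le1.
(* Condition (i) concerns triples, so a third vertex of [U] is needed before [x] and [y] are known
   to have any common neighbour. *)
have [z zU /andP[xz yz]] : exists2 z, z \in U & (x != z) && (y != z).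
  have : 0 < #|U :\ x :\ y|.
    have := circular_card_partL.
    by rewrite (cardsD1 x) xU (cardsD1 y (U :\ x)) !inE eq_sym xy yU.
  case/card_gt0P => z; rewrite !inE => /and3P[zy zx zU].
  by exists z => //; rewrite ![_ == z]eq_sym zy zx.
have [w /= /and4P[wx wy _ _]] := circular_ex_nbr xU yU zU xy xz yz.
(* For [t] other than [x] and [y], the common neighbour of [x], [y], [t] is one of [x] and [y],
   hence equals [w] by [cn_le1]. *)
have w_all t : t \in U -> edge G w t.
  move=> tU; case: (eqVneq x t) => [<- //|xt]; case: (eqVneq y t) => [<- //|yt].
  have [v /= /and4P[vx vy vt _]] := circular_ex_nbr xU yU tU xy xt yt.
  suff -> : w = v by [].
  by apply: cn_le1; rewrite in_common_nbr /= ?wx ?wy ?vx ?vy.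
have wW : w \in W.
  by apply: (edge_partL circular_bipartition xU); rewrite edge_sym.
have /card_gt0P[v] : 0 < #|W :\ w|.
  by rewrite lt0n; apply: contra W1 => /eqP W0; rewrite (cardsD1 w) wW W0.
rewrite !inE => /andP[/eqP vw vW]; apply: vw.
have [_ _ _ _ /(_ v vW)/card_gt2P[a [b [c [[aN bN cN] [ab bc ca]]]]]] := circG.
have /subsetP NU := nbr_partR vW.
have [aU bU cU] := And3 (NU a aN) (NU b bN) (NU c cN).
apply: (circular_eq_nbr (x := a) (y := b) (z := c)) => //; first by rewrite eq_sym.
- by rewrite /= -!in_nbr aN bN cN.
- by rewrite /= !w_all.
Qed.

End Circular.

Theorem theorem2p9 (T : finType) (G : graph T) (U W : {set T})
    (hG : nontrivial_circular_graph G U W) (u : T) (hu : u \in U) :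
  let U' := U :\ u in
  let S := [set x in W | x \notin nbr G u] in
  let W' := W :\: S in
  let G' := between G U' W' in
  W' = nbr G u /\ linear_graph G' U' W'.
Proof.
move=> U' S W' G'.
case: hG => circG ntG.
have bipG := circular_bipartition circG.
have W1 : #|W| != 1 by apply/eqP => W1; apply: ntG; right.
(* Removing [S] leaves the part of [N(u)] inside [W], and bipartiteness puts all of [N(u)] there. *)
have W'E : W' = nbr G u.
  apply/setP => x; rewrite in_setD in_set negb_and negbK in_nbr andb_orl andNb.
  by case: (boolP (edge G u x)) => // e; rewrite (edge_partL bipG hu e).
have inW' x : (x \in W') = edge G u x by rewrite W'E in_nbr.
have W'W x : x \in W' -> x \in W by rewrite inE => /andP[].
have U'U x : x \in U' -> x \in U by rewrite inE => /andP[].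
(* From a vertex of [U'], adjacency in [G'] is adjacency in [G] plus the test [edge G u y]; this
   brings [u] in as an extra vertex of the list. *)
have edgeL x y : x \in U' -> edge G' x y = edge G x y && edge G u y.
  move=> xU'; rewrite /= /between_edge xU' inW' /=.
  case: (boolP (x \in W')) => [/W'W xW|_]; last by rewrite orbF.
  by case: (bipartition_notin bipG (U'U _ xU') xW).
split=> //; split.
- split=> //.
    apply/pred0P => x /=; apply/negP => /andP[/U'U xU /W'W xW].
    exact: (bipartition_notin bipG xU xW).
  by move=> x y /andP[_ /orP[]] /andP[-> ->]; [left | right].
- move=> p q pU' qU' pq.
  have [_ _ _ /(_ u p q hu (U'U _ pU') (U'U _ qU')) + _] := circG.
  have [up uq] : u != p /\ u != q.
    by move: pU' qU'; rewrite !inE ![_ == u]eq_sym => /andP[-> _] /andP[-> _].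
  (* The value 1 in the goal is replaced by [cn G [:: u; p; q]], leaving two sets to compare
     pointwise. *)
  move=> /(_ (elimN eqP up) (elimN eqP uq) pq) <-.
  apply: eq_card => x; rewrite !in_common_nbr.
  (* Only [all] is expanded: [edge G'] stays folded so that [edgeL] applies. *)
  rewrite -[all (edge G' x) _]/[&& edge G' x p, edge G' x q & true].
  rewrite ![edge G' x _]edge_sym !edgeL //= !andbT ![edge G x _]edge_sym.
  by case: (edge G u x); rewrite ?andbT ?andbF.
- move=> x /setUP[xU'|xW'].
    move: (xU'); rewrite !inE => /andP[xu xU].
    (* The common neighbours of [x] and [u] in [G] are neighbours of [x] in [G']. *)
    apply: (leq_trans (circular_common_nbr2 circG W1 xU hu xu)).
    apply/subset_leq_card/subsetP => y; rewrite in_common_nbr in_nbr edgeL //=.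
    by rewrite andbT ![edge G y _]edge_sym.
  have [_ _ _ _ /(_ x (W'W _ xW'))] := circG.
  (* Splitting [u] off the at least three neighbours of [x] leaves two, all in [U']. *)
  rewrite /deg (cardsD1 u) in_nbr edge_sym -inW' xW' ltnS => /leq_trans; apply.
  apply/subset_leq_card/subsetP => y; rewrite in_setD1 in_nbr => /andP[yu e].
  have yU' : y \in U'.
    by rewrite in_setD1 yu (edge_partR bipG (W'W _ xW') e).
  by rewrite in_nbr edge_sym edgeL // edge_sym e -inW'.
Qed.
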